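(* Let $A\in R(\Omega)$, with associated sequences $(a_n),(b_n),(c_n),(d_n)$ having limits $a,b,c,d$. Let $\alpha\in\mathbb N$, $w\in\Omega$, suppose that the involution kernel of $A$ based at $x'=1^\alpha0w$ exists, and let $A^*$ be the associated dual potential. Then, writing a point $y\in\Omega^-$ as the sequence $y_1y_2y_3\dots$, for all $n\in\mathbb N$ and $z\in\Omega$: - $A^*(0^\infty)=a$; - $A^*(0^{n+1}1z)=a_{n+1}+(d_{n+1}-d_n)$; - $A^*(01^n0z)=b_\alpha+(d_1-c_{\alpha+1})+\sum_{j=2}^n(c_j-c_{j+\alpha})+(b_n-b_{n+\alpha})$; - $A^*(01^\infty)=b_\alpha+(d_1-c_{\alpha+1})+\sum_{j=2}^\infty(c_j-c_{j+\alpha})$; - $A^*(1^\infty)=c$; - $A^*(1^{n+1}0z)=c_{\alpha+n+1}+(b_{\alpha+n+1}-b_{\alpha+n})$; - $A^*(10^n1z)=c_{\alpha+1}+(b_{\alpha+1}-b_\alpha)$; - $A^*(10^\infty)=c_{\alpha+1}+(b_{\alpha+1}-b_\alpha)$.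
   Context: $\mathbb N=\{1,2,\dots\}$, $\Omega=\{0,1\}^{\mathbb N}$ with the product topology. $\Omega^-$ is a copy of $\Omega$ whose points are written $y=(y_1,y_2,\dots)$; $\hat\Omega=\Omega^-\times\Omega$, with points $(y|x)=(\dots,y_2,y_1|x_1,x_2,\dots)$. The Walters family $R(\Omega)$ is the set of continuous $A:\Omega\to\mathbb R$ for which there are convergent real sequences $(a_n),(b_n),(c_n),(d_n)$ such that for all $n\in\mathbb N$, $v\in\Omega$: $A(0^{n+1}1v)=a_{n+1}$, $A(01^n0v)=b_n$, $A(1^{n+1}0v)=c_{n+1}$, $A(10^n1v)=d_n$. The involution kernel of $A$ based at $x'\in\Omega$ is $W(y|x)=\sum_{n\ge1}[A(y_n,\dots,y_1,x_1,x_2,\dots)-A(y_n,\dots,y_1,x'_1,x'_2,\dots)]$; it exists if this series converges for every $(y|x)\in\hat\Omega$. The associated dual potential $A^*:\Omega^-\to\mathbb R$ is $$A^*(y)=A(y_1,x_1,x_2,\dots)+W\big((y_2,y_3,\dots)\,|\,(y_1,x_1,x_2,\dots)\big)-W(y|x),$$ whose right-hand side does not depend on $x\in\Omega$. *)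

(* Defs.v *)
From HB Require Import structures.
From mathcomp Require Import all_boot all_order all_algebra.
From mathcomp Require Import all_classical all_reals all_analysis.
Set Implicit Arguments.
Unset Strict Implicit.
Unset Printing Implicit Defensive.
Import Order.TTheory GRing.Theory Num.Theory.
Import numFieldNormedType.Exports.
Local Open Scope classical_set_scope.
Local Open Scope ring_scope.

(* The symbols 0 and 1 are [false] and [true]. Coordinates start at 0 here, so
   that the letter x_(i+1) of the sequence x_1 x_2 ... is [x i]. *)
Notation Omega := cantor_space.

Definition scons (s : bool) (x : Omega) : Omega :=
  fun i => if i is j.+1 then x j else s.

Definition shift (x : Omega) : Omega := fun i => x i.+1.

(* s^k x *)
Definition block (s : bool) (k : nat) (x : Omega) : Omega := iter k (scons s) x.

(* s^oo *)
Definition const_seq (s : bool) : Omega := fun=> s.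

(* y_n ... y_1 x_1 x_2 ... *)
Fixpoint past (n : nat) (y x : Omega) : Omega :=
  if n is m.+1 then scons (y m) (past m y x) else x.

(* The sequences are indexed by n >= 1: their values at 0 are irrelevant, and
   the potential does not constrain [a 1] and [c 1] either. *)
Definition walters_sequences (R : realType) (A : Omega -> R)
    (a b c d : nat -> R) : Prop :=
  [/\ cvgn a, cvgn b, cvgn c & cvgn d] /\
  forall (n : nat) (v : Omega), (0 < n)%N ->
    [/\ A (block false n.+1 (scons true v)) = a n.+1,
        A (scons false (block true n (scons false v))) = b n,
        A (block true n.+1 (scons false v)) = c n.+1
      & A (scons true (block false n (scons true v))) = d n].

Definition walters_family (R : realType) : set (Omega -> R) :=
  [set A | continuous A /\ exists a b c d, walters_sequences A a b c d].
Arguments walters_family R : clear implicits.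

Definition kernel_term (R : realType) (A : Omega -> R) (x' y x : Omega)
    (n : nat) : R :=
  A (past n y x) - A (past n y x').

Definition involution_kernel_exists (R : realType) (A : Omega -> R)
    (x' : Omega) : Prop :=
  forall y x : Omega,
    cvgn (fun N => \sum_(1 <= n < N) kernel_term A x' y x n).

(* W(y|x); meaningful only when [involution_kernel_exists A x'] *)
Definition involution_kernel (R : realType) (A : Omega -> R)
    (x' y x : Omega) : R :=
  limn (fun N => \sum_(1 <= n < N) kernel_term A x' y x n).

(* The defining expression of A^*(y), evaluated at the auxiliary point x. Its
   independence of x is not built in: statements about A^* are to be made for
   every x. *)
Definition dual_potential (R : realType) (A : Omega -> R)
    (x' x y : Omega) : R :=
  A (scons (y 0%N) x) + involution_kernel A x' (shift y) (scons (y 0%N) x)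
    - involution_kernel A x' y x.

(* Main.v *)
Require Import Defs.
From HB Require Import structures.
From mathcomp Require Import all_boot all_order all_algebra.
From mathcomp Require Import all_classical all_reals all_analysis.
From mathcomp Require Import lra.
Import Order.TTheory GRing.Theory Num.Theory.
Import numFieldNormedType.Exports.
Local Open Scope classical_set_scope.
Local Open Scope ring_scope.

(* The auxiliary point [x] telescopes out of A^*, leaving
   A^*(y) = A(y_1 x') + W(y_2 y_3 ... | y_1 x').  A potential of the Walters
   family only sees its argument up to the second change of letter, so the
   terms of this last series vanish once the word prepended to x' has two
   changes of letter; the remaining ones telescope or can be read off from the
   defining sequences. *)

(** * Reversed words prepended to a point *)

Lemma past_shift (k : nat) (y x : Omega) :
  past k.+1 y x = past k (Defs.shift y) (scons (y 0%N) x).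
Proof. by elim: k => //= k <-. Qed.

Lemma block_scons (s : bool) (k : nat) (x : Omega) :
  block s k (scons s x) = block s k.+1 x.
Proof. by rewrite /block iterSr. Qed.

Lemma block_block (s : bool) (j k : nat) (x : Omega) :
  block s j (block s k x) = block s (j + k) x.
Proof. by rewrite /block iterD. Qed.

Lemma past_const_seq (s : bool) (k : nat) (x : Omega) :
  past k (const_seq s) x = block s k x.
Proof. by elim: k => //= k ->. Qed.

(** Since [past] prepends letters in the order in which it reads them, the run [s]^n goes first,
    next to [x]; its reversal is invisible because its letters are equal. *)
Lemma past_add_block (s : bool) (n j : nat) (z x : Omega) :
  past (n + j) (block s n z) x = past j z (block s n x).
Proof.
elim: n x => // n IHn x.
by rewrite addSn past_shift -(block_scons s n x); exact: IHn.
Qed.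

Lemma past_block (s : bool) (k n : nat) (z x : Omega) : (k <= n)%N ->
  past k (block s n z) x = block s k x.
Proof.
move=> kn; rewrite -(subnKC kn) -block_block.
by rewrite -[X in past X]addn0 past_add_block.
Qed.

(** The letter and length of the leading run are chosen before [r], so they ignore the tail: the
    change of letter bounds the run. Each new letter either lengthens this run or starts one of
    length 1. *)
Lemma past_leading_run (k : nat) (z : Omega) (s : bool) :
  exists t j, (0 < j)%N /\ forall r, exists v,
    past k z (scons (~~ s) (scons s r)) = block t j (scons (~~ t) v).
Proof.
elim: k => [|k [t [j [j0 run]]]].
  by exists (~~ s), 1%N; split => // r; exists r; rewrite negbK.
have [zt|zt] := eqVneq (z k) t.
  exists t, j.+1; split => // r; have [v /= ->] := run r.
  by exists v; rewrite zt.
exists (z k), 1%N; split => // r; have [v /= ->] := run r.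
case: j j0 {run} => // j _; exists (block t j (scons (~~ t) v)).
by move: zt; case: (z k) t => [] [].
Qed.

(** * Potentials of the Walters family *)

Section WaltersPotential.
Context {R : realType} {A : Omega -> R} {a b c d : nat -> R}.
Hypothesis hseq : walters_sequences A a b c d.

Lemma walters_a (n : nat) (v : Omega) : (1 < n)%N ->
  A (block false n (scons true v)) = a n.
Proof. by case: n => // n n0; case: (hseq.2 n v n0). Qed.

Lemma walters_b (n : nat) (v : Omega) : (0 < n)%N ->
  A (scons false (block true n (scons false v))) = b n.
Proof. by move=> n0; case: (hseq.2 n v n0). Qed.

Lemma walters_c (n : nat) (v : Omega) : (1 < n)%N ->
  A (block true n (scons false v)) = c n.
Proof. by case: n => // n n0; case: (hseq.2 n v n0). Qed.

Lemma walters_d (n : nat) (v : Omega) : (0 < n)%N ->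
  A (scons true (block false n (scons true v))) = d n.
Proof. by move=> n0; case: (hseq.2 n v n0). Qed.

(** Set the outermost letter apart. If it agrees with the run after it, the run grows to length at
    least 2 and [a] or [c] gives the value; otherwise [b] or [d] does. Neither involves the tail.
    For [k = 0] this fails, as the second run may extend into [r]. *)
Lemma walters_past (k : nat) (z : Omega) (s : bool) (r r' : Omega) :
  (0 < k)%N ->
  A (past k z (scons (~~ s) (scons s r))) =
  A (past k z (scons (~~ s) (scons s r'))).
Proof.
case: k => // k _; have [t [j [j0 run]]] := past_leading_run k z s.
have [v /= ->] := run r; have [v' /= ->] := run r'.
case: (z k) t {run} => [] [] /=.
- by rewrite !(walters_c j.+1).
- by rewrite !walters_d.
- by rewrite !walters_b.
- by rewrite !(walters_a j.+1).
Qed.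

End WaltersPotential.

Lemma cvgn_eq_from {R : realType} (m : nat) (u v : nat -> R) (l : R) :
  (forall n, (m <= n)%N -> u n = v n) ->
  u n @[n --> \oo] --> l -> v n @[n --> \oo] --> l.
Proof.
move=> uv; apply: cvg_trans; apply: near_eq_cvg.
by exists m => // n /= mn; rewrite uv.
Qed.

(** * The dual potential at points starting with a letter and a run *)

Section DualPotential.
Context {R : realType} {A : Omega -> R} {x' : Omega}.
Hypothesis hW : involution_kernel_exists A x'.

Lemma cvg_involution_kernel (y x : Omega) :
  (fun N => \sum_(1 <= n < N) kernel_term A x' y x n) @ \oo
    --> involution_kernel A x' y x.
Proof. exact: hW. Qed.

(** After the first term is peeled off, the others compare [y_1 x] with [y_1 x'], whereas the kernel
    is based at [x']; hence a difference of two kernels. *)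
Lemma involution_kernel_split (y x : Omega) :
  involution_kernel A x' y x =
  A (scons (y 0%N) x) - A (scons (y 0%N) x')
  + (involution_kernel A x' (Defs.shift y) (scons (y 0%N) x)
     - involution_kernel A x' (Defs.shift y) (scons (y 0%N) x')).
Proof.
pose S u v N : R := \sum_(1 <= n < N) kernel_term A x' u v n.
set q := scons (y 0%N) x; set q' := scons (y 0%N) x'.
have split_sum N : (1 <= N)%N ->
    A q - A q' + (S (Defs.shift y) q N - S (Defs.shift y) q' N) = S y x N.+1.
  move=> N1; rewrite /S big_nat_recl //= -sumrB; congr (_ + _).
  apply: eq_bigr => n _; rewrite /kernel_term !past_shift -/q -/q'.
  by rewrite opprB addrA subrK.
have lhs : S y x N.+1 @[N --> \oo] --> involution_kernel A x' y x.
  by have := @cvg_involution_kernel y x; rewrite -cvg_shiftS.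
apply: (cvg_unique _ lhs) => //.
apply: (cvgn_eq_from 1 _ _ _ split_sum).
by apply: cvgD; [exact: cvg_cst | apply: cvgB; exact: cvg_involution_kernel].
Qed.

Lemma dual_potentialE (x y : Omega) :
  dual_potential A x' x y =
  A (scons (y 0%N) x')
  + involution_kernel A x' (Defs.shift y) (scons (y 0%N) x').
Proof. by rewrite /dual_potential (involution_kernel_split y x); lra. Qed.

(* The summands with [k > n.+1] vanish by [walters_past]: in their arguments a
   change of letter precedes [block s n], and at least one letter comes before
   it. *)
Lemma dual_potential_run (a b c d : nat -> R)
    (hseq : walters_sequences A a b c d) (x z : Omega) (s0 s : bool) (n : nat) :
  (0 < n)%N ->
  dual_potential A x' x (scons s0 (block s n (scons (~~ s) z))) =
  A (scons s0 x')
  + \sum_(1 <= k < n.+1) (A (block s k (scons s0 x')) - A (block s k x'))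
  + (A (scons (~~ s) (block s n (scons s0 x')))
     - A (scons (~~ s) (block s n x'))).
Proof.
move=> n0; rewrite dual_potentialE /= -addrA; congr (_ + _).
set u := Defs.shift _; set q := scons s0 x'.
have -> : u = block s n (scons (~~ s) z) by [].
apply: (cvg_unique _ (@cvg_involution_kernel u q)) => //.
(* The partial sums are constant from [n.+2] on, so the limit is that constant. *)
apply: (cvgn_eq_from n.+2 _ _ _ _ (cvg_cst _)) => N nN; apply/esym.
rewrite (@big_cat_nat _ _ _ n.+2) //=.
rewrite big_nat_recr //= -addrA; congr (_ + _).
  rewrite big_nat [RHS]big_nat; apply: eq_bigr => k /andP[_ kn].
  by rewrite /kernel_term !past_block.
rewrite {1}/kernel_term -addn1 !past_add_block /= -[RHS]addr0; congr (_ + _).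
rewrite big_nat big1 // => k /andP[kn _].
have nk : (n <= k)%N by rewrite ltnW // -addn1 ltnW.
rewrite /kernel_term -(subnKC nk) !past_add_block.
have : (1 < k - n)%N by rewrite ltn_subRL.
case: (k - n)%N => // j j0; rewrite !past_shift /=.
(* With [n] positive, the block shows its first [s] right after [~~ s]. *)
case: n n0 {u nN kn nk} => // n _.
by apply/eqP; rewrite subr_eq0; apply/eqP; exact: (walters_past hseq).
Qed.

(** Along a constant tail the prepended word gains no second change of letter, so no cutoff is
    available and the value stays a limit. *)
Lemma cvg_dual_potential_const (x : Omega) (s0 s : bool) :
  A (scons s0 x')
  + \sum_(1 <= k < N) (A (block s k (scons s0 x')) - A (block s k x'))
    @[N --> \oo] --> dual_potential A x' x (scons s0 (const_seq s)).
Proof.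
rewrite dual_potentialE /=; apply: cvgD; first exact: cvg_cst.
rewrite (_ : (fun N => _) = fun N => \sum_(1 <= k < N)
    kernel_term A x' (const_seq s) (scons s0 x') k).
  exact: cvg_involution_kernel.
apply/funext => N; apply: eq_bigr => k _.
by rewrite /kernel_term !past_const_seq.
Qed.

(** When the extra letter is [s] itself, it is absorbed by the run, and consecutive terms cancel. *)
Lemma sum_block_telescope (s : bool) (n : nat) :
  A (scons s x')
  + \sum_(1 <= k < n.+1) (A (block s k (scons s x')) - A (block s k x'))
  = A (block s n.+1 x').
Proof.
under eq_bigr do rewrite block_scons.
by rewrite (telescope_sumr (fun k => A (block s k x'))) //= addrC subrK.
Qed.

Lemma cvg_dual_potential_block (x : Omega) (s : bool) :
  A (block s n x') @[n --> \oo] --> dual_potential A x' x (const_seq s).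
Proof.
have <- : scons s (const_seq s) = const_seq s by apply/funext => -[].
apply: (cvgn_eq_from 1 _ _ _ _ (cvg_dual_potential_const x s s)).
by case=> // n _; rewrite sum_block_telescope.
Qed.

End DualPotential.

(** * Values for the base point 1^alpha 0 w *)

Theorem mainTheorem7 (R : realType) (A : Omega -> R)
    (a b c d : nat -> R) (la lb lc ld : R)
    (hA : walters_family R A)
    (hseq : walters_sequences A a b c d)
    (ha : a n @[n --> \oo] --> la) (hb : b n @[n --> \oo] --> lb)
    (hc : c n @[n --> \oo] --> lc) (hd : d n @[n --> \oo] --> ld)
    (alpha : nat) (halpha : (0 < alpha)%N) (w x' : Omega)
    (hx' : x' = block true alpha (scons false w))
    (hW : involution_kernel_exists A x')
    (x : Omega) :
  let Astar := dual_potential A x' x in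
  Astar (const_seq false) = la /\
  (forall (n : nat) (z : Omega), (0 < n)%N ->
     Astar (block false n.+1 (scons true z)) = a n.+1 + (d n.+1 - d n)) /\
  (forall (n : nat) (z : Omega), (0 < n)%N ->
     Astar (scons false (block true n (scons false z))) =
       b alpha + (d 1%N - c alpha.+1)
       + \sum_(2 <= j < n.+1) (c j - c (j + alpha)%N)
       + (b n - b (n + alpha)%N)) /\
  (cvgn (fun N => \sum_(2 <= j < N) (c j - c (j + alpha)%N)) /\
   Astar (scons false (const_seq true)) =
     b alpha + (d 1%N - c alpha.+1)
     + limn (fun N => \sum_(2 <= j < N) (c j - c (j + alpha)%N))) /\
  Astar (const_seq true) = lc /\
  (forall (n : nat) (z : Omega), (0 < n)%N ->
     Astar (block true n.+1 (scons false z)) =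
       c (alpha + n).+1 + (b (alpha + n).+1 - b (alpha + n)%N)) /\
  (forall (n : nat) (z : Omega), (0 < n)%N ->
     Astar (scons true (block false n (scons true z))) =
       c alpha.+1 + (b alpha.+1 - b alpha)) /\
  Astar (scons true (const_seq false)) =
    c alpha.+1 + (b alpha.+1 - b alpha).
Proof.
have ltS m : (1 < (alpha + m.+1))%N by rewrite -addn1 leq_add.
have x'E : x' = block true alpha (scons false w) by [].
(* The leading 1 of [x'] closes any run of 0s placed before it. *)
have x't : exists v, x' = scons true v.
  by case: (alpha) halpha x'E => // m _ ->; eexists.
have Ax'0 : A (scons false x') = b alpha by rewrite x'E (walters_b hseq).
(* A run of 1s merges with the initial run of [x']: this is the source of every shift by [alpha]. *)
have block1x' k : block true k x' = block true (alpha + k) (scons false w).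
  by rewrite x'E block_block addnC.
have A1x' k : A (block true k.+1 x') = c (alpha + k).+1.
  by rewrite block1x' (walters_c hseq) ?ltS // addnS.
have A01x' k : A (scons false (block true k x')) = b (alpha + k)%N.
  by rewrite block1x' (walters_b hseq) // ltn_addr.
have A0x' k : (1 < k)%N -> A (block false k x') = a k.
  by have [v ->] := x't => k1; rewrite (walters_a hseq).
have A10x' k : (0 < k)%N -> A (scons true (block false k x')) = d k.
  by have [v ->] := x't => k0; rewrite (walters_d hseq).
have term01 k : (1 < k)%N ->
    A (block true k (scons false x')) - A (block true k x')
    = c k - c (k + alpha)%N.
  by case: k => // k k0; rewrite (walters_c hseq) // A1x' addSn addnC.
(* The case [k = 1] is exceptional: 10[x'] starts with 101, so [d 1] replaces a value of [c], and
   the sum of the [c]'s starts at 2. *)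
have term1 : A (block true 1 (scons false x')) - A (block true 1 x')
    = d 1%N - c alpha.+1.
  by rewrite (A10x' 1%N) // A1x' addn0.
(* Both points start with exactly [k] zeros, so only the term [k = 1] survives, where [A] reads the
   length of the run of 1s. *)
have term10 k : (1 < k)%N ->
    A (block false k (scons true x')) - A (block false k x') = 0.
  by move=> k1; rewrite (walters_a hseq) // A0x' // subrr.
have term0 : A (block false 1 (scons true x')) - A (block false 1 x')
    = b alpha.+1 - b alpha.
  by rewrite (A01x' 1%N) (A01x' 0%N) addn0 addn1.
have Ax'1 : A (scons true x') = c alpha.+1 by rewrite (A1x' 0%N) addn0.
rewrite /=; split; last split; last split; last split; last split; last split;
  last split.
- apply: (cvg_unique _ (cvg_dual_potential_block hW x false)) => //.
  by apply: (cvgn_eq_from 2 _ _ _ _ ha) => n n2; rewrite A0x'.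
- move=> n z n0.
  (* The run of length [n.+1] is read as a letter followed by a run of length [n]. *)
  rewrite (dual_potential_run hW _ _ _ _ hseq x z false false n n0).
  rewrite sum_block_telescope A0x' //= block_scons.
  by rewrite (A10x' n.+1) // A10x'.
- move=> n z n0.
  rewrite (dual_potential_run hW _ _ _ _ hseq x z false true n n0).
  rewrite Ax'0 (@big_ltn _ _ _ 1) // term1 -!addrA; congr (_ + (_ + (_ + _))).
  rewrite big_nat [in RHS]big_nat; congr (_ + _).
    by apply: eq_bigr => k /andP[k1 _]; exact: term01.
  by rewrite /= (walters_b hseq) // A01x' addnC.
(* Convergence of the series is inherited from the existence of the kernel. *)
- have partial_sums :
      \sum_(2 <= j < N) (c j - c (j + alpha)%N) @[N --> \oo] -->
      dual_potential A x' x (scons false (const_seq true))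
      - (b alpha + (d 1%N - c alpha.+1)).
    apply: (cvgn_eq_from 2 _ _ _ _
      (cvgB (cvg_dual_potential_const hW x false true) (cvg_cst _))) => N N2 /=.
    rewrite Ax'0 big_ltn // term1 (addrA (b alpha)) [X in X - _]addrC addrK.
    rewrite big_nat [in RHS]big_nat.
    by apply: eq_bigr => k /andP[k1 _]; exact: term01.
  split; first by apply/cvg_ex; eexists; exact: partial_sums.
  by rewrite (cvg_lim _ partial_sums) // addrC subrK.
- apply: (cvg_unique _ (cvg_dual_potential_block hW x true)) => //.
  have := hc; rewrite -(cvg_shiftn alpha) => hc'.
  apply: (cvgn_eq_from 1 _ _ _ _ hc') => -[|n] // _.
  by rewrite A1x' addSn addnC.
- move=> n z n0.
  rewrite (dual_potential_run hW _ _ _ _ hseq x z true true n n0).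
  by rewrite sum_block_telescope A1x' /= block_scons !A01x' addnS.
- move=> n z n0.
  rewrite (dual_potential_run hW _ _ _ _ hseq x z true false n n0).
  rewrite Ax'1 big_ltn // term0 big_nat big1 => [|k /andP[k1 _]]; last first.
    exact: term10.
  by rewrite /= (walters_d hseq) // A10x' // subrr !addr0.
- apply: (cvg_unique _ (cvg_dual_potential_const hW x true false)) => //.
  apply: (cvgn_eq_from 2 _ _ _ _ (cvg_cst _)) => N N2.
  rewrite Ax'1 big_ltn // term0 big_nat big1 ?addr0 // => k /andP[k1 _].
  exact: term10.
Qed.
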